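(* Let $(P_t)_{t\ge 0}$ be the transition semigroup on $L^2(\mu)$ of a Markov process with invariant probability measure $\mu$, and let $(\mathcal L,\mathrm{Dom}(\mathcal L))$ be its generator. Then $$\frac{2(1-e^{-1})}{\mathrm{s}(\mathcal L)}\ \le\ \overline t_{\mathrm{rel}}(P)\ \le\ \frac{2e}{\mathrm{s}(\mathcal L)}\qquad\text{and}\qquad \frac{1-e^{-1}}{\mathrm{s}(\mathcal L)}\ \le\ t_{\mathrm{rel}}(P).$$ Moreover, $$\|\overline P_t f\|\ \le\ \frac{2}{t\cdot \mathrm{s}(\mathcal L)}\,\|f\|\qquad\text{for all } f\in L^2_0(\mu)\text{ and }t>0.$$
   Context: $S$ is a Polish space with its Borel $\sigma$-algebra, $(p_t)_{t\ge0}$ is the transition function of a time-homogeneous Markov process on $S$ with invariant probability measure $\mu$, and $(P_tf)(x)=\int f(y)\,p_t(x,\mathrm dy)$. Then $(P_t)_{t\ge 0}$ is a strongly continuous contraction semigroup on $L^2(\mu)$ with $\int P_tf\,\mathrm d\mu=\int f\,\mathrm d\mu$; $\langle\cdot,\cdot\rangle$ and $\|\cdot\|$ are the $L^2(\mu)$ inner product and norm; $L^2_0(\mu)=\{f\in L^2(\mu):\int f\,\mathrm d\mu=0\}$, which is preserved by $P_t$. $(\mathcal L,\mathrm{Dom}(\mathcal L))$ is the infinitesimal generator of $(P_t)$ on $L^2(\mu)$. Time averages: $\overline P_tf=\frac1t\int_0^tP_sf\,\mathrm ds$ for $t>0$. Relaxation times: $t_{\mathrm{rel}}(P)=\inf\{t\ge0:\|P_t\|_{L_0^2(\mu)\to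 L_0^2(\mu)}\le 1/e\}$ and $\overline t_{\mathrm{rel}}(P)=\inf\{t\ge0:\|\overline P_s\|_{L_0^2(\mu)\to L_0^2(\mu)}\le 1/e\text{ for all }s\ge t\}$. Singular value gap: $\mathrm s(\mathcal L)=\inf\{\|\mathcal Lf\|/\|f\|: f\in\mathrm{Dom}(\mathcal L)\cap L_0^2(\mu),\ f\ne0\}$. Conventions: $\inf\emptyset=\infty$, $1/0=\infty$, $1/\infty=0$; if $\mathrm s(\mathcal L)=0$ the last inequality is vacuous. *)

(* Defs.v *)
From HB Require Import structures.
From mathcomp Require Import all_boot all_order all_algebra.
From mathcomp Require Import all_classical all_reals all_analysis.

Set Implicit Arguments.
Unset Strict Implicit.
Unset Printing Implicit Defensive.

Import Order.TTheory GRing.Theory Num.Theory.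
Import numFieldNormedType.Exports.

Local Open Scope classical_set_scope.
Local Open Scope ring_scope.

(* Only the topology of [T] is given; the complete metric inducing it is
   existentially quantified. *)
Definition polish_space (R : realType) (T : topologicalType) : Prop :=
  (exists D : T -> T -> R,
    [/\ (forall x y, (D x y = 0) <-> (x = y)),
        (forall x y, D x y = D y x),
        (forall x y z, D x z <= D x y + D y z),
        (forall (x : T) (A : set T), nbhs x A <->
           exists2 e : R, 0 < e & [set y | D x y < e] `<=` A) &
        (forall u : nat -> T,
           (forall e : R, 0 < e -> exists N : nat, forall m n : nat,
              (N <= m)%N -> (N <= n)%N -> D (u m) (u n) < e) ->
           exists l : T, u n @[n --> \oo] --> l)])
  /\ (exists2 A : set T, countable A & dense A).

Notation borel S := (g_sigma_algebraType (@open S)).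

Section L2.
Context d (T : measurableType d) (R : realType).
Variable mu : {measure set T -> \bar R}.
Implicit Types (f g : T -> R) (A : (T -> R) -> (T -> R)).

(* Elements of L^2(mu) are represented by square-integrable functions; equality
   in L^2(mu) is equality mu-almost everywhere. *)
Definition L2 : set (T -> R) := [set f | f \in Lfun mu 2%:E].

Definition L2norm f : \bar R := 'N[mu]_2%:E[EFin \o f]%E.

Definition L20 : set (T -> R) :=
  [set f | L2 f /\ (\int[mu]_x (f x)%:E = 0)%E].

Definition opnorm_L20 A : \bar R :=
  ereal_sup [set L2norm (A f) | f in [set f | L20 f /\ (L2norm f <= 1)%E]].

(* Partition x_0 <= ... <= x_n of [a, b] with tags xi_i in [x_i, x_{i+1}]; the
   values of the two sequences beyond these indices are irrelevant. *)
Definition tagged_partition (a b : R) (n : nat) (x xi : nat -> R) : Prop :=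
  [/\ x 0%N = a, x n = b &
      forall i, (i < n)%N -> x i <= xi i /\ xi i <= x i.+1].

Definition riemann_sum (u : R -> T -> R) (n : nat) (x xi : nat -> R) : T -> R :=
  fun y => \sum_(i < n) (x i.+1 - x i) * u (xi i) y.

(* L^2(mu)-valued Riemann integral, i.e. limit in norm of the Riemann sums as
   the mesh tends to 0; for norm-continuous integrands it exists and is the
   Bochner integral. *)
Definition is_L2_RInt (u : R -> T -> R) (a b : R) (g : T -> R) : Prop :=
  L2 g /\
  forall e : R, 0 < e -> exists2 delta : R, 0 < delta &
    forall (n : nat) (x xi : nat -> R),
      tagged_partition a b n x xi ->
      (forall i, (i < n)%N -> x i.+1 - x i < delta) ->
      (L2norm (riemann_sum u n x xi \- g)%R <= e%:E)%E.

(* Determined up to mu-null sets when the integral exists. *)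
Definition L2_RInt (u : R -> T -> R) (a b : R) : T -> R :=
  xget (fun=> 0) [set g | is_L2_RInt u a b g].

End L2.

Section Markov.
Context d (T : measurableType d) (R : realType).
Variables (mu : {measure set T -> \bar R}) (p : R -> R.-pker T ~> T).
Implicit Types f g : T -> R.

(* Times are nonnegative: the kernels [p t] with [t < 0] are never used. *)
Definition transition_function : Prop :=
  (forall x A, measurable A -> p 0 x A = \d_x A) /\
  (forall (s t : R) (x : T) (A : set T), 0 <= s -> 0 <= t -> measurable A ->
     p (s + t) x A = (\int[p s x]_y p t y A)%E).

Definition invariant_measure : Prop :=
  forall (t : R) (A : set T), 0 <= t -> measurable A -> (\int[mu]_x p t x A)%E = mu A.

(* For [f] in L^2(mu) with mu invariant, the integral is finite for mu-almost
   every [x]. *)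
Definition semigroup (t : R) f : T -> R := fun x => \int[p t x]_y f y.

(* By the semigroup property, continuity at 0 is continuity at every time. *)
Definition strongly_continuous : Prop :=
  forall f, L2 mu f ->
    L2norm mu (fun x => semigroup t f x - f x) @[t --> 0^'+] --> 0%E.

Definition is_generator f g : Prop :=
  [/\ L2 mu f, L2 mu g &
      L2norm mu (fun x => (semigroup t f x - f x) / t - g x) @[t --> 0^'+]
        --> 0%E].

Definition generator_dom : set (T -> R) := [set f | exists g, is_generator f g].

(* Determined up to mu-null sets for [f] in the domain. *)
Definition generator f : T -> R := xget (fun=> 0) [set g | is_generator f g].

Definition time_average (t : R) f : T -> R :=
  fun x => t^-1 * L2_RInt mu (fun s => semigroup s f) 0 t x.

Definition t_rel : \bar R :=
  ereal_inf [set t%:E | t in [set t : R | 0 <= t /\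
    (opnorm_L20 mu (semigroup t) <= ((expR 1)^-1)%:E)%E]].

(* Time averages are only considered at positive times; this does not affect
   the infimum. *)
Definition t_rel_bar : \bar R :=
  ereal_inf [set t%:E | t in [set t : R | 0 <= t /\
    forall s : R, 0 < s -> t <= s ->
      (opnorm_L20 mu (time_average s) <= ((expR 1)^-1)%:E)%E]].

Definition singular_value_gap : \bar R :=
  ereal_inf [set (L2norm mu (generator f) / L2norm mu f)%E | f in
    [set f | [/\ generator_dom f, L20 mu f & ~ (f = cst 0 %[ae mu])]]].

End Markov.

(* Main.v *)
(* For f in L^2, h := \int_0^t P_s f ds lies in the domain of the generator L and
   L h = P_t f - f has norm at most 2 |f|, so that s(L) |h| <= 2 |f|; since the
   time average of f is h / t, this gives the last inequality and hence the upper
   bound. Conversely, for f in the domain, |P_t f - f| <= t |L f|, and averaging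
   over time halves this bound; if |P_t| (or the norm of the time average) is at
   most 1/e on L^2_0, the left-hand side is at least (1 - 1/e) |f|, which bounds
   t s(L) from below.
   The semigroup acts on representatives of classes in L^2, where it is linear
   and multiplicative only up to null sets; the abstract part of the argument
   therefore takes place in a vector space with a seminorm. *)
Require Import Defs.
From HB Require Import structures.
From mathcomp Require Import all_boot all_order all_algebra.
From mathcomp Require Import all_classical all_reals all_analysis.
From mathcomp Require Import measurable_realfun ring lra.

Set Implicit Arguments.
Unset Strict Implicit.
Unset Printing Implicit Defensive.

Import Order.TTheory GRing.Theory Num.Theory.
Import numFieldNormedType.Exports.

Local Open Scope classical_set_scope.
Local Open Scope ring_scope.

(** * Riemann integrals in a seminormed space *)

Ltac min_cases := repeat match goal with
  |- context [Order.min ?a ?b] => case: (leP a b) => ?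
  end.

(** * Overlaps of the cells of two partitions *)

Section overlap.
Context {R : realFieldType}.
Implicit Types x y : nat -> R.

(* The length of the intersection of [x i, x i.+1] and [y j, y j.+1], written as
   a double difference so that its sums over [i] and over [j] telescope. *)
Definition overlap x y (i j : nat) : R :=
  (Num.min (x i.+1) (y j.+1) - Num.min (x i) (y j.+1)) -
  (Num.min (x i.+1) (y j) - Num.min (x i) (y j)).

Lemma overlapC x y i j : overlap x y i j = overlap y x j i.
Proof. by rewrite /overlap !(minC (x _)); ring. Qed.

Lemma overlap_ge0 x y i j :
  x i <= x i.+1 -> y j <= y j.+1 -> 0 <= overlap x y i j.
Proof.
by move=> ? ?; rewrite /overlap; min_cases; lra.
Qed.

Lemma overlap_neq0 x y i j : x i <= x i.+1 -> y j <= y j.+1 ->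
  overlap x y i j != 0 -> x i <= y j.+1 /\ y j <= x i.+1.
Proof.
move=> xi yj w0; split; rewrite leNgt; apply: contra w0 => xy; apply/eqP;
  rewrite /overlap; min_cases; lra.
Qed.

(** Telescoping in [j] leaves the contributions of [b] and of [a]; the latter vanishes because both
    minima are then equal to [a]. *)
Lemma sum_overlap x y i n a b : y 0%N = a -> y n = b ->
  a <= x i -> x i <= x i.+1 -> x i.+1 <= b ->
  \sum_(j < n) overlap x y i j = x i.+1 - x i.
Proof.
move=> y0 yn ? ? ?.
rewrite -(big_mkord xpredT) /overlap.
rewrite (@telescope_sumr _ 0 n
  (fun j => Num.min (x i.+1) (y j) - Num.min (x i) (y j)))//.
by rewrite y0 yn; min_cases; lra.
Qed.

End overlap.

Section tagged_partition_theory.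
Context {R : realType}.
Implicit Types x xi : nat -> R.

Lemma tagged_partition_homo a b n x xi : tagged_partition a b n x xi ->
  forall i j, (i <= j <= n)%N -> x i <= x j.
Proof.
move=> [_ _ xP] i j /andP[ij]; elim: j ij => [|j IH].
  by rewrite leqn0 => /eqP ->.
rewrite leq_eqVlt => /predU1P[->//|]; rewrite ltnS => ij jn.
have [xj xj'] := xP j jn.
by rewrite (le_trans (IH ij (ltnW jn)))// (le_trans xj).
Qed.

Lemma uniform_partition (t : R) n : 0 <= t ->
  tagged_partition 0 t n.+1 (fun i => i%:R * (t / n.+1%:R))
    (fun i => i%:R * (t / n.+1%:R)).
Proof.
move=> t0; split; first by rewrite mul0r.
  by rewrite mulrCA divff ?mulr1// pnatr_eq0.
by move=> i _; split=> //; rewrite ler_wpM2r ?ler_nat// divr_ge0.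
Qed.

End tagged_partition_theory.

Section seminorm.
Context {R : realType} {V : lmodType R} (N : V -> R).
Hypothesis ND : forall u v, N (u + v) <= N u + N v.
Hypothesis NZ : forall a v, N (a *: v) = `|a| * N v.
Implicit Types (u v w g : V) (f : R -> V).

Lemma seminorm0 : N 0 = 0.
Proof. by rewrite -(scale0r 0) NZ normr0 mul0r. Qed.

Lemma seminormN v : N (- v) = N v.
Proof. by rewrite -scaleN1r NZ normrN1 mul1r. Qed.

Lemma seminorm_ge0 v : 0 <= N v.
Proof. by have := ND v (- v); rewrite subrr seminorm0 seminormN; lra. Qed.

Lemma seminormB u v : N (u - v) = N (v - u).
Proof. by rewrite -seminormN opprB. Qed.

Lemma seminorm_dist u v w : N (u - w) <= N (u - v) + N (v - w).
Proof. by rewrite (le_trans _ (ND _ _))// addrA subrK. Qed.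

Lemma seminorm_le u v : N u <= N v + N (u - v).
Proof. by rewrite (le_trans _ (ND _ _))// addrC subrK. Qed.

Lemma seminorm_sum (I : Type) (r : seq I) (Q : pred I) (F : I -> V) :
  N (\sum_(i <- r | Q i) F i) <= \sum_(i <- r | Q i) N (F i).
Proof.
elim/big_ind2 : _ => [|u a v b ua vb|//]; first by rewrite seminorm0.
by rewrite (le_trans (ND _ _))// lerD.
Qed.

Definition rsum f n (x xi : nat -> R) : V :=
  \sum_(i < n) (x i.+1 - x i) *: f (xi i).

(** The counterpart of [is_L2_RInt] for a seminorm; [g] is determined only up to vectors of seminorm
    0. *)
Definition is_RInt f (a b : R) g := forall e : R, 0 < e ->
  exists2 delta : R, 0 < delta & forall n x xi, tagged_partition a b n x xi ->
    (forall i, (i < n)%N -> x i.+1 - x i < delta) -> N (rsum f n x xi - g) <= e.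

(** Both sums are rewritten over pairs of cells with the weights [overlap], which add up to [b - a].
    Where the weight is nonzero the two cells meet, so their tags are at distance at most
    [d1 + d2]. *)
Lemma rsum_dist f a b d1 d2 K n x xi m y eta :
  tagged_partition a b n x xi -> tagged_partition a b m y eta ->
  (forall i, (i < n)%N -> x i.+1 - x i <= d1) ->
  (forall i, (i < m)%N -> y i.+1 - y i <= d2) ->
  (forall s r, a <= s -> a <= r -> `|s - r| <= d1 + d2 ->
     N (f s - f r) <= K) ->
  N (rsum f n x xi - rsum f m y eta) <= (b - a) * K.
Proof.
move=> px py xd yd fK.
have [x0 xn xP] := px; have [y0 ym yP] := py.
have xle := tagged_partition_homo px.
have yle := tagged_partition_homo py.
have ax i : (i <= n)%N -> a <= x i by move=> ?; rewrite -x0 xle.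
have bx i : (i <= n)%N -> x i <= b by move=> ?; rewrite -xn xle// leqnn andbT.
have ay i : (i <= m)%N -> a <= y i by move=> ?; rewrite -y0 yle.
have yb i : (i <= m)%N -> y i <= b by move=> ?; rewrite -ym yle// leqnn andbT.
have xS i : (i < n)%N -> x i <= x i.+1.
  by move=> ?; rewrite xle// leqnSn.
have yS i : (i < m)%N -> y i <= y i.+1.
  by move=> ?; rewrite yle// leqnSn.
have -> : rsum f n x xi =
    \sum_(i < n) \sum_(j < m) overlap x y i j *: f (xi i).
  apply: eq_bigr => i _; rewrite -scaler_suml (@sum_overlap _ _ _ _ _ a b)//.
  - by rewrite ax// ltnW.
  - exact: xS.
  - exact: bx.
have -> : rsum f m y eta =
    \sum_(i < n) \sum_(j < m) overlap x y i j *: f (eta j).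
  rewrite exchange_big; apply: eq_bigr => j _; rewrite -scaler_suml.
  under eq_bigr do rewrite overlapC.
  rewrite (@sum_overlap _ _ _ _ _ a b)//.
  - by rewrite ay// ltnW.
  - exact: yS.
  - exact: yb.
rewrite -sumrB (le_trans (seminorm_sum _ _ _))//.
have -> : (b - a) * K = \sum_(i < n) \sum_(j < m) overlap x y i j * K.
  transitivity ((\sum_(i < n) (x i.+1 - x i)) * K).
    by rewrite -(big_mkord xpredT (fun i => x i.+1 - x i)) telescope_sumr// xn x0.
  rewrite mulr_suml; apply: eq_bigr => i _.
  rewrite -mulr_suml (@sum_overlap _ _ _ _ _ a b)//.
  - by rewrite ax// ltnW.
  - exact: xS.
  - exact: bx.
apply: ler_sum => i _; rewrite -sumrB (le_trans (seminorm_sum _ _ _))//.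
apply: ler_sum => j _; rewrite -scalerBr NZ.
have w0 := overlap_ge0 (xS i (ltn_ord i)) (yS j (ltn_ord j)).
rewrite ger0_norm//; have [->|w1] := eqVneq (overlap x y i j) 0.
  by rewrite !mul0r.
rewrite ler_wpM2l//.
have [xy yx] := overlap_neq0 (xS i (ltn_ord i)) (yS j (ltn_ord j)) w1.
have [xi1 xi2] := xP i (ltn_ord i).
have [et1 et2] := yP j (ltn_ord j).
have xdi := xd i (ltn_ord i); have ydj := yd j (ltn_ord j).
have := ax i (ltnW (ltn_ord i)); have := ay j (ltnW (ltn_ord j)) => ? ?.
by apply: fK; [lra|lra|rewrite ler_norml; apply/andP; split; lra].
Qed.

Definition left_sum f (t : R) n : V :=
  (t / n.+1%:R) *: \sum_(i < n.+1) f (i%:R * (t / n.+1%:R)).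

Lemma left_sumE f t n : left_sum f t n =
  rsum f n.+1 (fun i => i%:R * (t / n.+1%:R)) (fun i => i%:R * (t / n.+1%:R)).
Proof.
rewrite /left_sum scaler_sumr; apply: eq_bigr => i _.
by rewrite -mulrBl -natrB// subSnn mul1r.
Qed.

Lemma small_step (t e : R) : 0 <= t -> 0 < e ->
  exists n0, forall n, (n0 <= n)%N -> t / n.+1%:R < e.
Proof.
move=> t0 e0; exists (Num.truncn (t / e)) => n tn.
rewrite ltr_pdivrMr// mulrC -ltr_pdivrMr//.
have /truncn_itv/andP[_] : 0 <= t / e by rewrite divr_ge0// ltW.
by move=> /lt_le_trans; apply; rewrite ler_nat.
Qed.

Lemma left_sum_cvg f (t : R) g : 0 <= t -> is_RInt f 0 t g -> forall e, 0 < e ->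
  exists n0, forall n, (n0 <= n)%N -> N (left_sum f t n - g) <= e.
Proof.
move=> t0 fg e /fg[d d0 dP]; have [n0 n0P] := small_step t0 d0.
exists n0 => n /n0P nd; rewrite left_sumE dP//.
  exact: uniform_partition.
by move=> i _; rewrite -mulrBl -natrB// subSnn mul1r.
Qed.

Definition seminorm_complete := forall s : nat -> V,
  (forall e, 0 < e -> exists n0, forall m n, (n0 <= m)%N -> (n0 <= n)%N ->
     N (s m - s n) <= e) ->
  exists g, forall e, 0 < e -> exists n0, forall n, (n0 <= n)%N ->
    N (s n - g) <= e.

(** By [rsum_dist], uniform continuity makes any two fine Riemann sums close. Completeness then
    gives a limit of the uniform left sums, and every fine sum is close to such a sum. *)
Lemma is_RInt_exists f (t : R) : seminorm_complete -> 0 <= t ->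
  (forall e, 0 < e -> exists2 d, 0 < d &
     forall s r, 0 <= s -> 0 <= r -> `|s - r| <= d -> N (f s - f r) <= e) ->
  exists g, is_RInt f 0 t g.
Proof.
move=> complN t0 fu.
have close e : 0 < e -> exists2 d, 0 < d & forall n x xi m y eta,
    tagged_partition 0 t n x xi -> tagged_partition 0 t m y eta ->
    (forall i, (i < n)%N -> x i.+1 - x i < d) ->
    (forall i, (i < m)%N -> y i.+1 - y i < d) ->
    N (rsum f n x xi - rsum f m y eta) <= e.
  (* Dividing by [t + 1] instead of [t] covers [t = 0]. *)
  move=> e0; have t1 : 0 < t + 1 by lra.
  have [d d0 dP] := fu _ (divr_gt0 e0 t1).
  exists (d / 2) => [|n x xi m y eta px py xd yd]; first lra.
  apply: (@le_trans _ _ ((t - 0) * (e / (t + 1)))).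
    apply: (@rsum_dist f 0 t (d / 2) (d / 2)) => // [i /xd/ltW//|i /yd/ltW//|].
    by move=> s r s0 r0; rewrite -splitr; exact: dP.
  by rewrite subr0 mulrA ler_pdivrMr// mulrC ler_pM2l//; lra.
have lsd n i : i.+1%:R * (t / n.+1%:R) - i%:R * (t / n.+1%:R) = t / n.+1%:R :> R.
  by rewrite -mulrBl -natrB// subSnn mul1r.
have [|g gP] := complN (left_sum f t).
  move=> e /close[d d0 dP]; have [n0 n0P] := small_step t0 d0.
  exists n0 => m n m0 n0n; rewrite !left_sumE; apply: dP.
  - exact: uniform_partition.
  - exact: uniform_partition.
  - by move=> i _; rewrite lsd n0P.
  - by move=> i _; rewrite lsd n0P.
exists g => e e0; have e20 : 0 < e / 2 by lra.
have [d d0 dP] := close _ e20; exists d => // n x xi px xd.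
have [n1 n1P] := small_step t0 d0; have [n2 n2P] := gP _ e20.
rewrite (splitr e) (le_trans (seminorm_dist _ (left_sum f t (maxn n1 n2)) _))//.
rewrite lerD//; last by rewrite n2P// leq_maxr.
rewrite left_sumE dP//; first exact: uniform_partition.
by move=> i _; rewrite lsd n1P// leq_maxl.
Qed.

End seminorm.

(** * Contraction semigroups *)

Section contraction_semigroup.
Context {R : realType} {V : lmodType R} (N : V -> R).
Hypothesis ND : forall u v, N (u + v) <= N u + N v.
Hypothesis NZ : forall a v, N (a *: v) = `|a| * N v.
Implicit Types (u v w g h : V) (s t r : R).

(* The semigroup laws are only required up to vectors of seminorm 0. *)
Variable P : R -> V -> V.
Hypothesis P_linear : forall t a u v, 0 <= t ->
  N (P t (a *: u + v) - (a *: P t u + P t v)) = 0.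
Hypothesis P_contraction : forall t v, 0 <= t -> N (P t v) <= N v.
Hypothesis P_add : forall s t v, 0 <= s -> 0 <= t ->
  N (P (s + t) v - P s (P t v)) = 0.
Hypothesis P_0 : forall v, N (P 0 v - v) = 0.
Hypothesis P_cont : forall v e, 0 < e ->
  exists2 d, 0 < d & forall t, 0 < t < d -> N (P t v - v) <= e.

Lemma semigroup_lip t u v : 0 <= t -> N (P t u - P t v) <= N (u - v).
Proof.
move=> t0; have := P_linear (-1) v u t0; rewrite !scaleN1r => Pl.
rewrite (le_trans (seminorm_le ND _ (P t (- v + u))))//.
rewrite seminormB// (addrC (P t u)) Pl addr0 (addrC u).
exact: P_contraction.
Qed.

Lemma semigroup0 t : 0 <= t -> N (P t 0) = 0.
Proof.
move=> t0; apply/eqP; rewrite eq_le seminorm_ge0// andbT.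
by rewrite (le_trans (P_contraction _ _))// (seminorm0 NZ).
Qed.

Lemma semigroupZ t a v : 0 <= t -> N (P t (a *: v) - a *: P t v) = 0.
Proof.
move=> t0; apply/eqP; rewrite eq_le seminorm_ge0// andbT.
have := P_linear a v 0 t0; rewrite addr0 => Pl.
rewrite (le_trans (seminorm_dist ND _ (a *: P t v + P t 0) _))// Pl add0r.
by rewrite addrAC subrr add0r semigroup0.
Qed.

Lemma semigroup_sum t n (F : nat -> V) : 0 <= t ->
  N (P t (\sum_(i < n) F i) - \sum_(i < n) P t (F i)) = 0.
Proof.
move=> t0; apply/eqP; rewrite eq_le seminorm_ge0// andbT.
elim: n => [|n IH]; first by rewrite !big_ord0 subr0 semigroup0.
rewrite !big_ord_recr/=; set A := \sum_(i < n) F i; set B := \sum_(i < n) _.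
have := P_linear 1 A (F n) t0; rewrite !scale1r => Pl.
rewrite (le_trans (seminorm_dist ND _ (P t A + P t (F n)) _))// Pl add0r.
by rewrite opprD addrACA subrr addr0.
Qed.

(** Up to seminorm 0, the left-hand vector is [P s] applied to [P r v - v], and [P s] is a
    contraction. *)
Lemma semigroup_dist s r v : 0 <= s -> 0 <= r ->
  N (P (s + r) v - P s v) <= N (P r v - v).
Proof.
move=> s0 r0; rewrite (le_trans (seminorm_dist ND _ (P s (P r v)) _))//.
by rewrite P_add// add0r semigroup_lip.
Qed.

Lemma semigroup_cont0 v e : 0 < e ->
  exists2 d, 0 < d & forall t, 0 <= t < d -> N (P t v - v) <= e.
Proof.
move=> e0; have [d d0 dP] := P_cont v e0; exists d => // t /andP[].
by rewrite le_eqVlt => /predU1P[<- _|t0 td]; [rewrite P_0 ltW|rewrite dP// t0].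
Qed.

(** By symmetry [r <= s]; [semigroup_dist] then reduces the claim to continuity at time 0, applied
    at [s - r]. *)
Lemma semigroup_unif_cont v e : 0 < e -> exists2 d, 0 < d &
  forall s r, 0 <= s -> 0 <= r -> `|s - r| <= d -> N (P s v - P r v) <= e.
Proof.
move=> e0; have [d d0 dP] := semigroup_cont0 v e0.
exists (d / 2) => [|s r s0 r0]; first lra.
wlog rs : s r s0 r0 / r <= s => [wh|sr].
  have [/wh|sr] := leP r s; first exact.
  by rewrite seminormB// distrC; apply: wh => //; exact: ltW.
have srE : s = r + (s - r) by ring.
rewrite {1}srE (le_trans (semigroup_dist _ _ _))// ?subr_ge0//.
rewrite dP// subr_ge0 rs/=.
by move: sr; rewrite ger0_norm ?subr_ge0//; lra.
Qed.

Lemma semigroup_RInt_exists v t : seminorm_complete N -> 0 <= t ->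
  exists g, is_RInt N (P ^~ v) 0 t g.
Proof. by move=> ? ?; apply: is_RInt_exists => //; exact: semigroup_unif_cont. Qed.

(** The generator as a relation, since its value is determined only up to seminorm 0. *)
Definition is_gen v g := forall e, 0 < e -> exists2 d, 0 < d &
  forall t, 0 < t < d -> N (t^-1 *: (P t v - v) - g) <= e.

Lemma semigroup_step n r v : 0 <= r -> N (P (n%:R * r) v - v) <= n%:R * N (P r v - v).
Proof.
move=> r0; elim: n => [|n IH]; first by rewrite !mul0r P_0.
rewrite (le_trans (seminorm_dist ND _ (P (n%:R * r) v) _))//.
rewrite -natr1 !mulrDl !mul1r addrC lerD//.
by rewrite semigroup_dist// mulr_ge0.
Qed.

(* Telescoping over [n] steps of length [t / n] lets [t / n] tend to 0. *)
Lemma semigroup_gen_le v g t : 0 <= t -> is_gen v g -> N (P t v - v) <= t * N g.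
Proof.
rewrite le_eqVlt => /predU1P[<- _|t0 vg]; first by rewrite P_0 mul0r.
(* An error of [e / t] per unit of time adds up to [e] over [[0, t]]. *)
apply/ler_addgt0Pr => e e0; have [d d0 dP] := vg _ (divr_gt0 e0 t0).
have [n /(_ n (leqnn _)) nd] := small_step (ltW t0) d0.
set r := t / n.+1%:R in nd; have r0 : 0 < r by rewrite divr_gt0.
have tE : t = n.+1%:R * r by rewrite mulrCA divff ?mulr1// pnatr_eq0.
have Pr : N (P r v - v) <= r * (N g + e / t).
  rewrite mulrC -ler_pdivrMr// mulrC -(gtr0_norm (x := r^-1)) ?invr_gt0//.
  rewrite -NZ (le_trans (seminorm_le ND _ g))// lerD2l dP// r0.
  by [].
rewrite [X in P X](_ : t = n.+1%:R * r)//.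
rewrite (le_trans (semigroup_step _ _ (ltW r0)))//.
rewrite (le_trans (ler_wpM2l _ Pr))// mulrA -tE mulrDr mulrCA divff ?mulr1//.
by rewrite gt_eqF.
Qed.

Lemma gen_unique v g g' : is_gen v g -> is_gen v g' -> N (g - g') = 0.
Proof.
move=> vg vg'; apply/eqP; rewrite eq_le seminorm_ge0// andbT.
apply/ler_addgt0Pr => e e0; have e20 : 0 < e / 2 by lra.
have [d d0 dP] := vg _ e20; have [d' d'0 dP'] := vg' _ e20.
have m0 : 0 < Num.min d d' by rewrite lt_min d0.
set c := Num.min d d' / 2.
have [cd cd'] : Num.min d d' <= d /\ Num.min d d' <= d'.
  by rewrite !ge_min !lexx orbT.
have c0 : 0 < c by rewrite /c; lra.
have md : 0 < c < d by rewrite c0 /c/=; lra.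
have md' : 0 < c < d' by rewrite c0 /c/=; lra.
rewrite add0r (splitr e).
rewrite (le_trans (seminorm_dist ND _ (c^-1 *: (P c v - v)) _))//.
by rewrite lerD ?dP'// seminormB// dP.
Qed.

(** Serves to normalise vectors of the domain to norm 1. *)
Lemma genZ a v g : is_gen v g -> is_gen (a *: v) (a *: g).
Proof.
(* The summand 1 covers [a = 0]. *)
move=> vg e e0; have a1 : 0 < `|a| + 1 by rewrite ltr_wpDl.
have [d d0 dP] := vg _ (divr_gt0 e0 a1); exists d => // t td.
have /andP[t0 _] := td.
rewrite (le_trans (seminorm_dist ND _ (t^-1 *: (a *: P t v - a *: v)) _))//.
rewrite -(scalerBr t^-1) NZ opprB addrA subrK semigroupZ ?(ltW t0)// mulr0 add0r.
rewrite -scalerBr scalerA mulrC -scalerA -scalerBr NZ.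
rewrite (le_trans (ler_wpM2l _ (dP _ td)))// mulrCA ler_piMr ?(ltW e0)//.
by rewrite ler_pdivrMr// mul1r ler_wpDr.
Qed.

(** * The integral [h] of the orbit of [v] over [[0, t]] *)

Section integral.
Variables (t : R) (v h : V).
Hypotheses (t0 : 0 < t) (vh : is_RInt N (P ^~ v) 0 t h).

(** The identity is exact for left sums, all of whose terms have the same value under [phi], and the
    bound on [phi] carries it over to the limit. *)
Lemma integral_functional (phi : V -> R) :
  (forall a u w, phi (a *: u + w) = a * phi u + phi w) ->
  (forall u, `|phi u| <= N u) ->
  (forall s u, 0 <= s -> phi (P s u) = phi u) -> phi h = t * phi v.
Proof.
move=> phiL phiN phiP; apply/eqP; rewrite -subr_eq0 -normr_le0.
apply/ler_addgt0Pr => e e0.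
have [n /(_ n (leqnn _)) nP] := left_sum_cvg (ltW t0) vh e0.
have phi0 : phi 0 = 0.
  by have := phiL 1 0 0; rewrite scale1r addr0 mul1r; lra.
have phiZ a u : phi (a *: u) = a * phi u by rewrite -[X in phi X]addr0 phiL phi0 addr0.
have phiD u w : phi (u + w) = phi u + phi w.
  by rewrite -[u in LHS]scale1r phiL mul1r.
have phiM u : phi (- u) = - phi u by rewrite -scaleN1r phiZ mulN1r.
rewrite add0r (le_trans _ nP)// (le_trans _ (phiN _))//.
rewrite phiD phiM phiZ (big_morph phi phiD phi0).
under eq_bigr => i _.
  rewrite phiP; last by rewrite mulr_ge0// divr_ge0 ?ltW//.
  over.
rewrite sumr_const card_ord -[phi v *+ _]mulr_natl mulrA divfK ?pnatr_eq0//.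
by rewrite distrC.
Qed.

Lemma integral_le : N h <= t * N v.
Proof.
apply/ler_addgt0Pr => e e0.
have [n /(_ n (leqnn _)) nP] := left_sum_cvg (ltW t0) vh e0.
rewrite (le_trans (seminorm_le ND _ (left_sum (P ^~ v) t n)))//.
rewrite seminormB// lerD// NZ ger0_norm ?divr_ge0 ?(ltW t0)//.
rewrite mulrAC ler_pdivrMr// -mulrA ler_wpM2l ?(ltW t0)//.
rewrite (le_trans (seminorm_sum ND NZ _ _ _))// mulr_natr.
rewrite -[n.+1 in leRHS]card_ord -sumr_const ler_sum// => i _.
by rewrite P_contraction// mulr_ge0// divr_ge0// ltW.
Qed.

(** The constant is the integral of [s] over [[0, t]], as [P s v - v] has seminorm at most
    [s * N g]. This is the gain of a factor 2 for time averages. *)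
Lemma integral_sub_le g : is_gen v g -> N (h - t *: v) <= t ^+ 2 / 2 * N g.
Proof.
move=> vg; apply/ler_addgt0Pr => e e0.
have [n /(_ n (leqnn _)) nP] := left_sum_cvg (ltW t0) vh e0.
rewrite (le_trans (seminorm_dist ND _ (left_sum (P ^~ v) t n) _))//.
rewrite seminormB// addrC lerD// /left_sum.
set r := t / n.+1%:R; have r0 : 0 < r by rewrite divr_gt0.
have tE : t = n.+1%:R * r by rewrite mulrCA divff ?mulr1// pnatr_eq0.
clearbody r.
have -> : t *: v = r *: \sum_(i < n.+1) v.
  by rewrite sumr_const card_ord -scaler_nat scalerA mulrC -tE.
rewrite -scalerBr -sumrB NZ ger0_norm ?(ltW r0)//.
apply: (@le_trans _ _ (r * \sum_(i < n.+1) (i%:R * r * N g))).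
  rewrite ler_wpM2l ?(ltW r0)// (le_trans (seminorm_sum ND NZ _ _ _))//.
  rewrite ler_sum// => i _; apply: semigroup_gen_le => //.
  by rewrite mulr_ge0 ?(ltW r0).
rewrite -!mulr_suml tE exprMn !mulrA ler_wpM2r ?seminorm_ge0//.
rewrite [leRHS](_ : _ = r * (n.+1%:R ^+ 2 / 2) * r); last by ring.
rewrite !ler_wpM2r ?ler_wpM2l ?(ltW r0)//.
(* The sum of the integers below [m] is at most [m ^ 2 / 2]. *)
elim: n.+1 => [|m IH]; first by rewrite big_ord0 expr0n mul0r.
rewrite big_ord_recr/= -natr1; have : 0 <= m%:R :> R := ler0n R m.
by move: IH; set a := \sum_(_ < _) _; lra.
Qed.

(* [P_r h - h] is the integral over [t, t + r] minus the integral over [0, r]. *)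
Lemma integral_shift_le r K : 0 < r ->
  (forall s, 0 <= s <= r -> N (P s v - v) <= K) ->
  N (P r h - h - r *: (P t v - v)) <= 2 * r * K.
Proof.
move=> r0 vK; set w := P t v - v; apply/ler_addgt0Pr => e e0.
have e40 : 0 < e / 4 by lra.
have w1 : 0 < 1 + N w by rewrite ltr_pwDl// seminorm_ge0.
have [d1 d10 d1P] := semigroup_cont0 h e40.
have [n2 n2P] := left_sum_cvg (ltW t0) vh e40.
(* The mesh [q] has to be below [d1] to compare [P r h] with [P p h], and so small that
   [q * N w <= e / 4] to replace [r] by [p]; the summand 1 covers [N w = 0]. *)
have dm : 0 < Num.min d1 (e / 4 / (1 + N w)) by rewrite lt_min d10 divr_gt0.
have [n1 n1P] := small_step (ltW t0) dm.
set n := maxn n1 n2; set U := left_sum (P ^~ v) t n.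
have hU : N (U - h) <= e / 4 by apply: n2P; rewrite leq_maxr.
have := n1P n (leq_maxl _ _); set q := t / n.+1%:R.
rewrite lt_min => /andP[qd qe].
have q0 : 0 < q by rewrite divr_gt0.
have tE : t = n.+1%:R * q by rewrite mulrCA divff ?mulr1// pnatr_eq0.
(* The number of whole cells in [[0, r]], so that [p := m * q] lies within [q] below [r]. *)
set m := Num.truncn (r / q).
have /truncn_itv/andP[] : 0 <= r / q by rewrite divr_ge0// ltW.
rewrite -/m ler_pdivlMr// ltr_pdivrMr// -natr1 mulrDl mul1r => mr rm.
set p := m%:R * q in mr rm *; have p0 : 0 <= p by rewrite mulr_ge0// ltW.
(* Shifting the left sum by [p] moves its indices by [m]: after cancellation only the last [m]
   shifted terms and the first [m] original ones remain. *)
have shift : N (P p U - U - p *: w) <= 2 * r * K.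
  have K0 : 0 <= K by rewrite (le_trans _ (vK 0 _)) ?seminorm_ge0// lexx ltW.
  pose F i := P (i%:R * q) v.
  have PU : N (P p U - q *: \sum_(i < n.+1) F (i + m)%N) = 0.
    apply/eqP; rewrite eq_le seminorm_ge0// andbT /U /left_sum -/q.
    rewrite (le_trans (seminorm_dist ND _ (q *: P p (\sum_(i < n.+1) F i)) _))//.
    rewrite semigroupZ// add0r -scalerBr NZ.
    rewrite mulr_ge0_le0//.
    rewrite (le_trans (seminorm_dist ND _ (\sum_(i < n.+1) P p (F i)) _))//.
    rewrite (semigroup_sum _ F)// add0r -sumrB (le_trans (seminorm_sum ND NZ _ _ _))//.
    rewrite big1// => i _; rewrite seminormB// /F natrD mulrDl (addrC (i%:R * q)) P_add//.
    by rewrite mulr_ge0// ltW.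
  have sumE : \sum_(i < n.+1) F (i + m)%N - \sum_(i < n.+1) F i =
      \sum_(j < m) (F (n.+1 + j)%N - F j).
    rewrite sumrB; apply/eqP; rewrite subr_eq addrAC eq_sym subr_eq; apply/eqP.
    transitivity (\sum_(i < n.+1 + m) F i).
      by rewrite big_split_ord/=; exact: addrC.
    rewrite addnC big_split_ord/= addrC; congr (_ + _).
    by apply: eq_bigr => i _; rewrite addnC.
  rewrite (le_trans (seminorm_dist ND _ (q *: \sum_(i < n.+1) F (i + m)%N - U) _))//.
  rewrite [X in N X + _](_ : _ = P p U - q *: \sum_(i < n.+1) F (i + m)%N); last first.
    by rewrite opprD addrACA subrr addr0.
  rewrite PU add0r /U /left_sum -/q -scalerBr sumE.
  have -> : p *: w = q *: \sum_(j < m) w.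
    by rewrite sumr_const card_ord -scaler_nat scalerA mulrC.
  rewrite -scalerBr -sumrB NZ ger0_norm ?(ltW q0)//.
  apply: (@le_trans _ _ (q * \sum_(j < m) (K + K))); last first.
    rewrite sumr_const card_ord -[(K + K) *+ m]mulr_natl mulrA (mulrC q) -/p.
    have := ler_wpM2r K0 mr; lra.
  rewrite ler_wpM2l ?(ltW q0)// (le_trans (seminorm_sum ND NZ _ _ _))//.
  rewrite ler_sum// => j _.
  have jq0 : 0 <= j%:R * q by rewrite mulr_ge0// ltW.
  have jq : N (P (j%:R * q) v - v) <= K.
    rewrite vK// jq0 (le_trans _ mr)// ler_wpM2r ?(ltW q0)//.
    by rewrite ler_nat ltnW.
  (* Since [t = n.+1 * q], both brackets are increments over a time [j * q <= r], starting at [t]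
     and at 0; each has seminorm at most [K]. *)
  rewrite [X in N X](_ : _ = (F (n.+1 + j)%N - P t v) - (F j - v)); last first.
    by rewrite /w !opprD !opprK !addrA; congr (_ + _); rewrite addrAC.
  rewrite (le_trans (ND _ _))// seminormN// lerD//.
  by rewrite /F natrD mulrDl -tE (le_trans (semigroup_dist _ _ _))// ltW.
have rp : 0 <= r - p < d1 by rewrite subr_ge0 mr/=; lra.
have P1 : N (P r h - P p h) <= e / 4.
  rewrite [X in P X h - _](_ : r = p + (r - p)); last by ring.
  rewrite (le_trans (semigroup_dist _ _ _)) ?d1P//.
  by case/andP: rp.
have P2 : N (P p h - P p U) <= e / 4.
  by rewrite (le_trans (semigroup_lip _ _ _))// seminormB.
have P3 : N ((p - r) *: w) <= e / 4.
  rewrite NZ distrC ger0_norm; last by case/andP: rp.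
  apply: (@le_trans _ _ (q * (1 + N w))).
    rewrite ler_pM//; last by rewrite lerDr.
    - by case/andP: rp.
    - exact: seminorm_ge0.
    - lra.
  by rewrite -ler_pdivlMr// ltW.
(* The main term is bounded by [shift], each of the other four by [e / 4]. *)
rewrite [X in N X](_ : _ = (P r h - P p h) + (P p h - P p U) +
    (P p U - U - p *: w) + (U - h) + (p - r) *: w); last first.
  by rewrite scalerBl !addrA !subrK (addrAC _ (- (p *: w)) U) subrK
    (addrAC _ (- h) (p *: w)) subrK.
do 4! rewrite (le_trans (ND _ _))// -lerBrDr.
lra.
Qed.

(** Dividing [integral_shift_le] by [r] leaves an error [2 * K], and continuity at 0 allows
    [K = e / 2] for small [r]. *)
Lemma integral_gen : is_gen h (P t v - v).
Proof.
move=> e e0; have e20 : 0 < e / 2 by lra.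
have [d d0 dP] := semigroup_cont0 v e20; exists d => // r /andP[r0 rd].
have : N (P r h - h - r *: (P t v - v)) <= 2 * r * (e / 2).
  by apply: integral_shift_le => // s /andP[s0 sr]; rewrite dP// s0 (le_lt_trans sr).
rewrite [X in N X](_ : _ = r *: (r^-1 *: (P r h - h) - (P t v - v))); last first.
  by rewrite [RHS]scalerBr scalerA mulfV ?gt_eqF// scale1r.
by rewrite NZ gtr0_norm// (_ : 2 * r * _ = r * e) ?ler_pM2l//; field.
Qed.

End integral.
End contraction_semigroup.

(** * Integration against a probability kernel *)

Section bind.
Context d1 d2 (T1 : measurableType d1) (T2 : measurableType d2) (R : realType).
Variables (m : probability T1 R) (k : R.-pker T1 ~> T2).
Variable nu : {measure set T2 -> \bar R}.
Hypothesis bind : forall A, measurable A -> (\int[m]_x k x A)%E = nu A.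

(** By [bind], [nu] is the composition of [m], seen as a constant kernel on [unit], with [k]. This
    is applied both to invariance and to the Chapman-Kolmogorov equation. *)
Lemma ge0_integral_bind (f : T2 -> \bar R) :
  (forall y, 0 <= f y)%E -> measurable_fun [set: T2] f ->
  (\int[nu]_y f y = \int[m]_x \int[k x]_y f y)%E.
Proof.
move=> f0 mf.
pose l : unit -> pprobability T1 R := cst m.
have ml : measurable_fun setT l by exact: measurable_cst.
have := integral_kcomp (kprobability ml) (kernel.kernel_snd k) tt f0 mf.
rewrite /= => <-; apply: eq_measure_integral => A mA _.
by rewrite -bind.
Qed.

Lemma measurable_integral_kernel (f : T2 -> \bar R) :
  (forall y, 0 <= f y)%E -> measurable_fun [set: T2] f ->
  measurable_fun setT (fun x => \int[k x]_y f y)%E.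
Proof.
by move=> f0 mf; apply: measurable_fun_integral_kernel => // U mU;
  exact: measurable_kernel.
Qed.

Lemma measurable_Rintegral_kernel (f : T2 -> R) : measurable_fun [set: T2] f ->
  measurable_fun setT (fun x => \int[k x]_y f y).
Proof.
move=> mf; have mF : measurable_fun setT (EFin \o f) by exact/measurable_EFinP.
apply: measurableT_comp; first exact: fine_measurable.
apply: (eq_measurable_fun (fun x => \int[k x]_y (EFin \o f)^\+ y -
    \int[k x]_y (EFin \o f)^\- y)%E) => [x _|]; first by rewrite [RHS]integralE.
apply: emeasurable_funB.
  by apply: measurable_integral_kernel => //; exact: measurable_funepos.
by apply: measurable_integral_kernel => //; exact: measurable_funeneg.
Qed.

Section signed.
Variable f : T2 -> R.
Hypothesis intf : nu.-integrable setT (EFin \o f).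
Let Ap x := (\int[k x]_y (EFin \o f)^\+ y)%E.
Let An x := (\int[k x]_y (EFin \o f)^\- y)%E.

Let mf : measurable_fun setT (EFin \o f).
Proof. exact: measurable_int intf. Qed.

Let Ap0 x : (0 <= Ap x)%E. Proof. exact: integral_ge0. Qed.
Let An0 x : (0 <= An x)%E. Proof. exact: integral_ge0. Qed.

Let ApE : (\int[m]_x Ap x = \int[nu]_y (EFin \o f)^\+ y)%E.
Proof. by rewrite -ge0_integral_bind//; exact: measurable_funepos. Qed.

Let AnE : (\int[m]_x An x = \int[nu]_y (EFin \o f)^\- y)%E.
Proof. by rewrite -ge0_integral_bind//; exact: measurable_funeneg. Qed.

Let iAp : m.-integrable setT Ap.
Proof.
apply/integrableP; split.
  by apply: measurable_integral_kernel => //; exact: measurable_funepos.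
under eq_integral do rewrite gee0_abs//.
by rewrite ApE; apply: integrable_lty => //; exact: integrable_funepos.
Qed.

Let iAn : m.-integrable setT An.
Proof.
apply/integrableP; split.
  by apply: measurable_integral_kernel => //; exact: measurable_funeneg.
under eq_integral do rewrite gee0_abs//.
by rewrite AnE; apply: integrable_lty => //; exact: integrable_funeneg.
Qed.

Let RintE x : \int[k x]_y f y = fine (Ap x - An x)%E.
Proof. by rewrite /Rintegral integralE. Qed.

(** The integrand is dominated by [Ap + An]; where one of these is infinite, [fine] returns its
    default value 0. *)
Lemma integrable_bind :
  m.-integrable setT (fun x => (\int[k x]_y f y)%:E).
Proof.
apply: le_integrable (integrableD measurableT iAp iAn) => //.
  by apply/measurable_EFinP; apply: measurable_Rintegral_kernel; exact/measurable_EFinP.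
move=> x _; rewrite RintE; have := An0 x; have := Ap0 x.
case: (Ap x) => [a| |]//; case: (An x) => [b| |]//=; rewrite ?normr0//.
rewrite !lee_fin => a0 b0; rewrite (ger0_norm (addr_ge0 a0 b0)).
by rewrite ler_norml; apply/andP; split; lra.
Qed.

(** The inner integral is [Ap x - An x] wherever both terms are finite, hence almost everywhere. *)
Lemma Rintegral_bind :
  (\int[m]_x (\int[k x]_y f y)%:E = \int[nu]_y (f y)%:E)%E.
Proof.
rewrite [RHS]integralE -ApE -AnE -integralB//.
apply: ae_eq_integral => //.
- exact: measurable_int integrable_bind.
- by apply: emeasurable_funB; apply: measurable_int; [exact: iAp|exact: iAn].
have aep := integrable_ae measurableT iAp.
have aen := integrable_ae measurableT iAn.
apply: filterS2 aep aen => x /(_ Logic.I) fp /(_ Logic.I) fn _.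
by rewrite RintE fineK// fin_numB fp fn.
Qed.

Lemma ae_integrable_bind : {ae m, forall x, (k x).-integrable setT (EFin \o f)}.
Proof.
have aep := integrable_ae measurableT iAp.
have aen := integrable_ae measurableT iAn.
apply: filterS2 aep aen => x /(_ Logic.I) fp /(_ Logic.I) fn.
apply/integrableP; split => //.
rewrite [ltLHS](_ : _ = Ap x + An x)%E; last first.
  rewrite /Ap /An -ge0_integralD//; last 2 first.
  - exact: measurable_funepos.
  - exact: measurable_funeneg.
  by apply: eq_integral => y _; rewrite -/((abse \o (EFin \o f)) y) fune_abse.
by rewrite lte_add_pinfty// ltey_eq ?fp ?fn.
Qed.

End signed.

End bind.

(** * Square-integrable functions *)

Section square_integrable.
Context d (T : measurableType d) (R : realType).
Variable mu : {measure set T -> \bar R}.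
Implicit Types f g : T -> R.

Lemma L2normE f : L2norm mu f = ((\int[mu]_x (f x ^+ 2)%:E) `^ 2^-1)%E.
Proof.
rewrite /L2norm unlock; congr (_ `^ _)%E; apply: eq_integral => x _ /=.
by rewrite powR_mulrn// real_normK// num_real.
Qed.

Lemma L2norm_ge0 f : (0 <= L2norm mu f)%E.
Proof. exact: Lnorm_ge0. Qed.

Lemma integral_sqr_ge0 f : (0 <= \int[mu]_x (f x ^+ 2)%:E)%E.
Proof. by apply: integral_ge0 => x _; rewrite lee_fin sqr_ge0. Qed.

Lemma L2norm_le_cst f (c : R) : 0 <= c ->
  (\int[mu]_x (f x ^+ 2)%:E <= (c ^+ 2)%:E)%E -> (L2norm mu f <= c%:E)%E.
Proof.
move=> c0 fc; rewrite L2normE.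
have -> : c%:E = ((c ^+ 2)%:E `^ 2^-1)%E.
  by rewrite poweR_EFin -powR_mulrn// -powRrM mulfV// powRr1.
rewrite gt0_ler_poweR ?invr_ge0//.
- by rewrite in_itv/= leey integral_sqr_ge0.
- by rewrite in_itv/= leey lee_fin sqr_ge0.
Qed.

Lemma sqr_L2norm f (c : R) : L2norm mu f = c%:E ->
  (\int[mu]_x (f x ^+ 2)%:E = (c ^+ 2)%:E)%E.
Proof.
move=> fc; have c0 : 0 <= c by rewrite -lee_fin -fc L2norm_ge0.
rewrite -powR_mulrn// -poweR_EFin -fc L2normE -poweRrM mulVf// poweRe1//.
exact: integral_sqr_ge0.
Qed.

Lemma L2P f : L2 mu f <->
  measurable_fun setT f /\ (\int[mu]_x (f x ^+ 2)%:E < +oo)%E.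
Proof.
rewrite /L2/= inE; split=> [/andP[]|[mf foo]].
  rewrite !inE/= /finite_norm => mf; rewrite -/(L2norm mu f) => fl; split => //.
  have fn : L2norm mu f \is a fin_num by rewrite ge0_fin_numE// L2norm_ge0.
  by rewrite (sqr_L2norm (esym (fineK fn))) ltry.
apply/andP; split; rewrite inE//= /finite_norm -/(L2norm mu f) L2normE.
exact: poweR_lty.
Qed.

Lemma integrable_sqr f : measurable_fun setT f ->
  (\int[mu]_x (f x ^+ 2)%:E < +oo)%E ->
  mu.-integrable setT (EFin \o (fun x => f x ^+ 2)).
Proof.
move=> mf foo; apply/integrableP; split.
  by apply/measurable_EFinP; exact: measurable_funX.
by under eq_integral do rewrite gee0_abs ?lee_fin ?sqr_ge0//.
Qed.

Hypothesis mu1 : mu setT = 1%E.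

Lemma L2_integrable f : L2 mu f -> mu.-integrable setT (EFin \o f).
Proof.
move=> fL2; apply/Lfun1_integrable; apply: Lfun_subset12 => //.
by rewrite mu1.
Qed.

(* Jensen's inequality, from [2 c f - c ^ 2 <= f ^ 2] with c the mean of f;
   it also holds when [f] is not integrable, since its mean is then 0. *)
Lemma sqr_Rintegral_le f : measurable_fun setT f ->
  (((\int[mu]_x f x) ^+ 2)%:E <= \int[mu]_x (f x ^+ 2)%:E)%E.
Proof.
move=> mf; have [->|foo] := eqVneq (\int[mu]_x (f x ^+ 2)%:E)%E +oo%E.
  by rewrite leey.
have {}foo : (\int[mu]_x (f x ^+ 2)%:E < +oo)%E by rewrite ltey.
have intf : mu.-integrable setT (EFin \o f) by exact/L2_integrable/L2P.
have intf2 := integrable_sqr mf foo.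
rewrite -[leRHS]fineK; last by rewrite ge0_fin_numE// integral_sqr_ge0.
rewrite lee_fin; set c := \int[mu]_x f x.
have intc : mu.-integrable setT (EFin \o cst (c ^+ 2)).
  apply/integrableP; split; first exact/measurable_EFinP/measurable_cst.
  under eq_integral do rewrite /=.
  by rewrite integral_cst//= mu1 mule1 ltry.
have intcf : mu.-integrable setT (EFin \o (fun x => 2 * c * f x)).
  by have := integrableZl measurableT (2 * c) intf; apply: eq_integrable.
have -> : c ^+ 2 = \int[mu]_x (2 * c * f x - c ^+ 2).
  rewrite RintegralB// RintegralZl// Rintegral_cst// mu1/= mulr1 -/c.
  by ring.
apply: le_Rintegral => //.
  by have := integrableB measurableT intcf intc; apply: eq_integrable.
by move=> x _; have := sqr_ge0 (f x - c); rewrite sqrrB mulr2n; lra.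
Qed.

End square_integrable.

Lemma is_cvg_series_nneseries (R : realType) (u : nat -> R) : (forall k, 0 <= u k) ->
  (\sum_(k <oo) (u k)%:E < +oo)%E -> cvgn (series u).
Proof.
move=> u0 uoo; apply: nondecreasing_is_cvgn.
  by apply/nondecreasing_seqP => n; rewrite seriesSr lerDl.
have sfin : (\sum_(k <oo) (u k)%:E \is a fin_num)%E.
  by rewrite ge0_fin_numE// nneseries_ge0// => k _ _; rewrite lee_fin.
exists (fine (\sum_(k <oo) (u k)%:E)) => _ [n _ <-].
rewrite -lee_fin fineK// /series/= -sumEFin.
by apply: nneseries_lim_ge => k _ _; rewrite lee_fin.
Qed.

(** * Square-integrable functions as a complete seminormed space *)

Section L2_seminorm.
Context d (T : measurableType d) (R : realType).
Variable mu : probability T R.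
Notation V := (LfunType mu (lee1n 2)).
Implicit Types (f g : V).

Definition nrm2 f : R := fine (L2norm mu f).

Lemma nrm2E f : L2norm mu f = (nrm2 f)%:E.
Proof. by rewrite [RHS]finite_norm_fine. Qed.

Lemma nrm2D f g : nrm2 (f + g) <= nrm2 f + nrm2 g.
Proof. exact: ler_LnormD. Qed.

Lemma nrm2Z a f : nrm2 (a *: f) = `|a| * nrm2 f.
Proof. by apply: EFin_inj; rewrite -nrm2E EFinM -nrm2E; exact: LnormZ. Qed.

Lemma nrm2_ge0 f : 0 <= nrm2 f.
Proof. by rewrite -lee_fin -nrm2E L2norm_ge0. Qed.

Lemma sqr_nrm2 f : (\int[mu]_x (f x ^+ 2)%:E = (nrm2 f ^+ 2)%:E)%E.
Proof. exact/sqr_L2norm/nrm2E. Qed.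

Lemma nrm2_le f (c : R) : 0 <= c ->
  (\int[mu]_x (f x ^+ 2)%:E <= (c ^+ 2)%:E)%E -> nrm2 f <= c.
Proof. by move=> c0 fc; rewrite -lee_fin -nrm2E L2norm_le_cst. Qed.

Lemma L2_val f : L2 mu f.
Proof. exact: LfunP. Qed.

Lemma Lfun2_integrable f : mu.-integrable setT (EFin \o f).
Proof. by apply: L2_integrable (L2_val f); exact: probability_setT. Qed.

Lemma eq_nrm2 f g : f = g %[ae mu] -> nrm2 (f - g) = 0.
Proof.
move=> fg; apply: EFin_inj; rewrite -nrm2E L2normE.
rewrite (ae_eq_integral (cst 0%E))//.
- by rewrite integral0 poweR0r// invr_eq0.
- by apply/measurable_EFinP; apply: measurable_funX.
- apply: filterS fg => x /(_ Logic.I) fgx _ /=.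
  by rewrite [X in X ^+ 2](_ : _ = f x - g x)// fgx subrr expr0n.
Qed.

Lemma val_sum n (F : nat -> V) x :
  (\sum_(i < n) F i : V) x = \sum_(i < n) F i x.
Proof. by elim: n => [|n IH]; rewrite ?big_ord0// !big_ord_recr/= -IH. Qed.

Lemma normr_Rintegral_le f : `|\int[mu]_x f x| <= nrm2 f.
Proof.
rewrite -ler_sqr ?nnegrE ?nrm2_ge0// real_normK ?num_real//.
rewrite -lee_fin -sqr_nrm2 sqr_Rintegral_le//; exact: probability_setT.
Qed.

(** Jensen's inequality for the absolute value of [f]; it turns summable L^2 increments into
    summable L^1 increments. *)
Lemma integral_normr_le f : (\int[mu]_x (`|f x|)%:E <= (nrm2 f)%:E)%E.
Proof.
have mf : measurable_fun setT (fun x => `|f x|) by exact: measurableT_comp.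
have intf : mu.-integrable setT (EFin \o (fun x => `|f x|)).
  by have /integrable_abse := Lfun2_integrable f; apply: eq_integrable.
have := sqr_Rintegral_le (probability_setT mu) mf.
under eq_integral do rewrite real_normK ?num_real//.
rewrite sqr_nrm2 lee_fin ler_sqr ?nnegrE ?nrm2_ge0 ?Rintegral_ge0//.
by rewrite -lee_fin /Rintegral fineK//; exact: integrable_fin_num intf.
Qed.

(* A subsequence with summable increments converges almost everywhere; Fatou's
   lemma turns the pointwise limit into a limit in norm. *)
Lemma L2_cauchy_cvg (s : nat -> V) :
  (forall e, 0 < e -> exists n0, forall m n, (n0 <= m)%N -> (n0 <= n)%N ->
     nrm2 (s m - s n) <= e) ->
  exists g : V, forall e, 0 < e -> exists n0, forall n, (n0 <= n)%N ->
    nrm2 (s n - g) <= e.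
Proof.
move=> s_cauchy.
have e_gt0 k : 0 < (2 ^ (k + 1))%:R^-1 :> R by rewrite invr_gt0 ltr0n expn_gt0.
have /choice[M MP] k := s_cauchy _ (e_gt0 k).
(* Summing the successors makes [phi] monotone and at least as large as both [M k] and [k]. *)
pose phi k := (\sum_(i < k.+1) (M i).+1)%N.
have phiS k : (phi k <= phi k.+1)%N by rewrite /phi [leqRHS]big_ord_recr leq_addr.
have Mphi k : (M k <= phi k)%N.
  by rewrite /phi big_ord_recr/= (leq_trans (leqnSn _))// leq_addl.
have kphi k : (k <= phi k)%N.
  rewrite /phi -[leqLHS]card_ord -sum1_card big_ord_recr/=.
  by rewrite (leq_trans _ (leq_addr _ _))// leq_sum.
pose D k : V := s (phi k.+1) - s (phi k).
have nD k : nrm2 (D k) <= (2 ^ (k + 1))%:R^-1.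
  by apply: MP => //; exact: leq_trans (phiS k).
have sumD : (\int[mu]_x (\sum_(k <oo) (`|D k x|)%:E) < +oo)%E.
  rewrite integral_nneseries//; last first.
    by move=> n; apply/measurable_EFinP; exact: measurableT_comp.
  apply: (@le_lt_trans _ _ (\sum_(k <oo) (1 / (2 ^ (k + 1))%:R)%:E)%E).
    apply: lee_nneseries => k _; first by move=> _; exact: integral_ge0.
    by rewrite (le_trans (integral_normr_le _))// lee_fin div1r.
  have /cvg_lim -> // := @cvg_geometric_eseries_half R 1 0.
  exact: ltry.
have msum : measurable_fun setT (fun x => \sum_(k <oo) (`|D k x|)%:E)%E.
  apply: ge0_emeasurable_sum => [k x _ _|k _]; first by rewrite lee_fin.
  by apply/measurable_EFinP; exact: measurableT_comp.
have sum0 x : (0 <= \sum_(k <oo) (`|D k x|)%:E)%E.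
  by apply: nneseries_ge0 => k _ _; rewrite lee_fin.
(* The upper limit exists everywhere and is measurable; it agrees with the limit wherever the latter
   exists. *)
pose g x := fine (limn_esup (fun k => (s (phi k) x)%:E)).
have mg : measurable_fun setT g.
  apply: measurableT_comp; first exact: fine_measurable.
  by apply: measurable_fun_limn_esup => k; exact/measurable_EFinP.
have sg : {ae mu, forall x, s (phi k) x @[k --> \oo] --> g x}.
  have isum : mu.-integrable setT (fun x => \sum_(k <oo) (`|D k x|)%:E)%E.
    apply/integrableP; split => //.
    by under eq_integral do rewrite gee0_abs//.
  apply: filterS (integrable_ae measurableT isum) => x /(_ Logic.I) Dx.
  have : cvgn (series (fun k => D k x)).
    apply: normed_cvg; apply: is_cvg_series_nneseries => //.
      by move=> k /=.
    by move: Dx; rewrite ge0_fin_numE.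
  have -> : series (fun k => D k x) = (fun k => s (phi k) x - s (phi 0%N) x).
    by rewrite -[RHS](telescopeK (fun k => s (phi k) x)).
  move=> cv; have {}cv : cvgn (fun k => s (phi k) x).
    rewrite (_ : (fun k => _) =
      (fun k => s (phi k) x - s (phi 0%N) x) \+ cst (s (phi 0%N) x)).
      by apply: is_cvgD => //; exact: is_cvg_cst.
    by apply/funext => k /=; rewrite subrK.
  have /cvg_limn_einf_sup[_ E] : (s (phi k) x)%:E @[k --> \oo] --> (limn (fun k => s (phi k) x))%:E.
    by apply: cvg_EFin; [exact: nearW|exact: cv].
  by rewrite /g E.
have key e n0 : 0 < e -> (forall m n, (n0 <= m)%N -> (n0 <= n)%N -> nrm2 (s m - s n) <= e) ->
    forall n, (n0 <= n)%N -> (\int[mu]_x ((s n x - g x) ^+ 2)%:E <= (e ^+ 2)%:E)%E.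
  move=> e0 eP n n0n.
  (* The shift by [n0] puts every index [phi (k + n0)] beyond [n0], so that each [h k] has integral
     at most [e ^ 2]. *)
  pose h k x := (((s n - s (phi (k + n0)%N) : V) x) ^+ 2)%:E.
  have mh k : measurable_fun setT (h k).
    by apply/measurable_EFinP; exact: measurable_funX.
  have h0 k x : setT x -> (0 <= h k x)%E by rewrite lee_fin sqr_ge0.
  have -> : (\int[mu]_x ((s n x - g x) ^+ 2)%:E = \int[mu]_x limn_einf (h ^~ x))%E.
    apply: ae_eq_integral => //.
    - by apply/measurable_EFinP; apply: measurable_funX; exact: measurable_funB.
    - apply: measurableT_comp => //.
      by apply: measurable_fun_limn_esup => k; exact: measurableT_comp.
    apply: filterS sg => x gx _.
    have /cvg_limn_einf_sup[-> //] :
        h k x @[k --> \oo] --> ((s n x - g x) ^+ 2)%:E.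
      apply: cvg_EFin; first exact: nearW.
      have : s n x - s (phi (k + n0)%N) x @[k --> \oo] --> s n x - g x.
        apply: cvgB; first exact: cvg_cst.
        by have := gx; rewrite -(cvg_shiftn n0).
      by move=> c; exact: (cvgM c c).
  apply: le_trans (fatou mu measurableT mh h0) _.
  rewrite limn_einf_lim; apply: lime_le; first exact: is_cvg_einfs.
  apply: nearW => k; apply: (@le_trans _ _ (\int[mu]_x h k x)%E).
    by apply: ereal_inf_lbound; exists k => /=.
  rewrite sqr_nrm2 lee_fin ler_sqr ?nnegrE ?nrm2_ge0//; last exact: ltW.
  by rewrite eP// (leq_trans _ (kphi _))// leq_addl.
have [n0 n0P] := s_cauchy 1 ltr01.
have wL2 : L2 mu (fun x => s n0 x - g x).
  apply/L2P; split; first exact: measurable_funB.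
  by rewrite (le_lt_trans (key 1 n0 ltr01 n0P n0 (leqnn _)))// ltry.
(* Fatou's lemma gives square-integrability of [s n0 - g]; the limit is recovered from it by
   subtraction. *)
pose G : V := s n0 - Lfun_Sub (lee1n 2) wL2.
have GE x : G x = g x.
  rewrite [LHS](_ : _ = s n0 x - (s n0 x - g x))//.
  by ring.
exists G => e e0; have [n1 n1P] := s_cauchy e e0; exists n1 => n n1n.
apply: nrm2_le; first exact: ltW.
rewrite (le_trans _ (key e n1 e0 n1P n n1n))// le_eqVlt; apply/orP; left.
by apply/eqP; apply: eq_integral => x _; rewrite -GE.
Qed.

Lemma L2_complete : seminorm_complete nrm2.
Proof. exact: L2_cauchy_cvg. Qed.

End L2_seminorm.

(** * The Markov semigroup *)

Lemma at_right_cvg0P (R : realType) (F : R -> \bar R) : (forall t, 0 <= F t)%E ->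
  F t @[t --> 0^'+] --> 0%E <->
  (forall e, 0 < e -> exists2 d, 0 < d & forall t, 0 < t < d -> (F t <= e%:E)%E).
Proof.
move=> F0; split=> [F_cvg e e0|FP].
  have [|d /= d0 dP] := F_cvg [set x | (x < e%:E)%E].
    by apply: open_nbhs_nbhs; split; [exact: open_ereal_lt_ereal|rewrite /= lte_fin].
  exists d => // t /andP[t0 td]; apply: ltW; apply: dP => //=.
  by rewrite sub0r normrN gtr0_norm.
have near_le e : 0 < e -> \forall t \near 0^'+, (F t <= e%:E)%E.
  move=> /FP[d d0 dP]; exists d => //= t.
  by rewrite /= sub0r normrN => + t0; rewrite gtr0_norm// => td; rewrite dP// t0.
apply/fine_cvgP; split.
  apply: filterS (near_le 1 ltr01) => t Ft.
  by rewrite ge0_fin_numE// (le_lt_trans Ft)// ltry.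
apply/cvgr0Pnorm_le => e e0; apply: filterS (near_le e e0) => t Ft.
rewrite ger0_norm ?fine_ge0// -lee_fin fineK//.
by rewrite ge0_fin_numE// (le_lt_trans Ft)// ltry.
Qed.

Section kernel_probability.
Context d1 d2 (T1 : measurableType d1) (T2 : measurableType d2) (R : realType).
Variables (k : R.-pker T1 ~> T2) (x : T1).

(* An alias of [k x] on which its probability structure can be declared. *)
Definition pker_at : set T2 -> \bar R := k x.

HB.instance Definition _ := Measure.on pker_at.

Let pker_atT : pker_at setT = 1%E. Proof. exact: prob_kernel. Qed.

HB.instance Definition _ := Measure_isProbability.Build _ _ _ pker_at pker_atT.

End kernel_probability.

Section markov_semigroup.
Context d (T : measurableType d) (R : realType).
Variables (mu : probability T R) (p : R -> R.-pker T ~> T).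
Hypothesis hp : transition_function p.
Hypothesis hmu : invariant_measure mu p.
Hypothesis hP : strongly_continuous mu p.
Notation V := (LfunType mu (lee1n 2)).
Implicit Types (f g u v : V) (s t : R).

Lemma invariant_bind t : 0 <= t ->
  forall A, measurable A -> (\int[mu]_x p t x A)%E = mu A.
Proof. by move=> t0 A mA; exact: hmu. Qed.

Lemma chapman_kolmogorov_bind s t x : 0 <= s -> 0 <= t ->
  forall A, measurable A -> (\int[pker_at (p s) x]_y p t y A = p (s + t) x A)%E.
Proof. by move=> s0 t0 A mA; rewrite hp.2. Qed.

(** Jensen's inequality for each probability [p t x], followed by integration in [x] and invariance
    of [mu]. *)
Lemma integral_sqr_semigroup_le t (f : T -> R) : 0 <= t -> L2 mu f ->
  (\int[mu]_x (semigroup p t f x ^+ 2)%:E <= \int[mu]_x (f x ^+ 2)%:E)%E.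
Proof.
move=> t0 /L2P[mf _].
have mf2 : measurable_fun setT (fun x => (f x ^+ 2)%:E).
  by apply/measurable_EFinP; exact: measurable_funX.
have f20 x : (0 <= (f x ^+ 2)%:E)%E by rewrite lee_fin sqr_ge0.
rewrite [leRHS](ge0_integral_bind (invariant_bind t0))//.
apply: ge0_le_integral => //.
- by move=> x _; rewrite lee_fin sqr_ge0.
- by apply/measurable_EFinP; apply: measurable_funX; exact: measurable_Rintegral_kernel.
- exact: measurable_integral_kernel.
- by move=> x _; apply: sqr_Rintegral_le => //; exact: prob_kernel.
Qed.

Lemma semigroup_L2 t (f : T -> R) : 0 <= t -> L2 mu f -> L2 mu (semigroup p t f).
Proof.
move=> t0 fL2; have [mf foo] := (L2P mu f).1 fL2; apply/L2P; split.
  exact: measurable_Rintegral_kernel.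
exact: le_lt_trans (integral_sqr_semigroup_le t0 fL2) foo.
Qed.

(* Equal to 0 at a negative time if [semigroup p t f] is not in L^2. *)
Definition semigroupL t f : V := insubd (0 : V) (semigroup p t f).

Lemma semigroupLE t f : 0 <= t -> (semigroupL t f : T -> R) = semigroup p t f.
Proof. by move=> t0; rewrite [LHS]insubdK//; exact/semigroup_L2/L2_val. Qed.

Lemma ae_integrable_kernel t f : 0 <= t ->
  {ae mu, forall x, (p t x).-integrable setT (EFin \o f)}.
Proof.
move=> t0; exact: (ae_integrable_bind (invariant_bind t0) (Lfun2_integrable f)).
Qed.

(** Linearity of the integral applies at those [x] for which [u] and [v] are integrable under
    [p t x], which are almost all. *)
Lemma semigroupL_linear t a u v : 0 <= t ->
  nrm2 (semigroupL t (a *: u + v) - (a *: semigroupL t u + semigroupL t v)) = 0.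
Proof.
move=> t0; apply: eq_nrm2.
apply: filterS2 (ae_integrable_kernel u t0) (ae_integrable_kernel v t0).
move=> x iu iv _.
rewrite [RHS](_ : _ = a * semigroupL t u x + semigroupL t v x)// !semigroupLE//.
rewrite /semigroup -RintegralZl// -RintegralD//.
by have := integrableZl measurableT a iu; apply: eq_integrable.
Qed.

Lemma semigroupL_contraction t v : 0 <= t -> nrm2 (semigroupL t v) <= nrm2 v.
Proof.
move=> t0; apply: nrm2_le; first exact: nrm2_ge0.
by rewrite -sqr_nrm2 semigroupLE// integral_sqr_semigroup_le//; exact: L2_val.
Qed.

(** [Rintegral_bind] for the probability [p s x] applies whenever [v] is integrable under
    [p (s + t) x], hence for almost every [x]. *)
Lemma semigroupL_add s t v : 0 <= s -> 0 <= t ->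
  nrm2 (semigroupL (s + t) v - semigroupL s (semigroupL t v)) = 0.
Proof.
move=> s0 t0; apply: eq_nrm2.
apply: filterS (ae_integrable_kernel v (addr_ge0 s0 t0)) => x ix _.
rewrite !semigroupLE ?addr_ge0// /semigroup; congr fine.
by rewrite -(Rintegral_bind (chapman_kolmogorov_bind x s0 t0) ix).
Qed.

Lemma semigroupL_0 v : nrm2 (semigroupL 0 v - v) = 0.
Proof.
apply: eq_nrm2; apply: nearW => x _; rewrite semigroupLE// /semigroup /Rintegral.
rewrite (eq_measure_integral (\d_x)) => [|A mA _]; last exact: hp.1.
rewrite integral_dirac//; first by rewrite diracT mul1e.
by apply/measurable_EFinP.
Qed.

Local Notation N := (@nrm2 _ _ _ mu).
Local Notation ND := (@nrm2D _ _ _ mu).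
Local Notation NZ := (@nrm2Z _ _ _ mu).

Lemma L2_lift (f : T -> R) : L2 mu f -> exists F : V, (F : T -> R) = f.
Proof. by move=> fL2; exists (Lfun_Sub (lee1n 2) fL2). Qed.

Lemma semigroupL_cont v e : 0 < e ->
  exists2 r, 0 < r & forall t, 0 < t < r -> nrm2 (semigroupL t v - v) <= e.
Proof.
move=> e0; have := hP (L2_val v).
move/at_right_cvg0P => /(_ (fun=> L2norm_ge0 _ _) e e0)[r r0 rP].
exists r => // t /[dup] /rP + /andP[t0 _].
by rewrite -semigroupLE ?(ltW t0)// -lee_fin -nrm2E.
Qed.

Lemma is_generatorP f g : is_generator mu p f g <-> is_gen N semigroupL f g.
Proof.
have E t : 0 < t ->
    L2norm mu (fun x => (semigroup p t f x - f x) / t - g x) =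
    (nrm2 (t^-1 *: (semigroupL t f - f) - g))%:E.
  move=> t0; rewrite -nrm2E -semigroupLE ?ltW//; congr L2norm.
  by apply/funext => x; rewrite mulrC.
split=> [[_ _ /at_right_cvg0P]|fg].
  move=> /(_ (fun=> L2norm_ge0 _ _)) fg e /fg[r r0 rP]; exists r => // t /[dup].
  by move=> /rP + /andP[t0 _]; rewrite E// lee_fin.
split; [exact: L2_val|exact: L2_val|apply/at_right_cvg0P => [t|e e0]].
  exact: L2norm_ge0.
have [r r0 rP] := fg e e0; exists r => // t /[dup] /rP + /andP[t0 _].
by rewrite E// lee_fin.
Qed.

Lemma is_L2_RIntP t f g :
  is_L2_RInt mu (fun s => semigroup p s f) 0 t g <->
  is_RInt N (semigroupL ^~ f) 0 t g.
Proof.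
have E n x xi : tagged_partition 0 t n x xi ->
    L2norm mu (riemann_sum (fun s => semigroup p s f) n x xi \- g) =
    (nrm2 (rsum (semigroupL ^~ f) n x xi - g))%:E.
  move=> px; have [x0 _ xP] := px; rewrite -nrm2E; congr L2norm.
  apply/funext => y; rewrite [RHS](_ : _ = (rsum (semigroupL ^~ f) n x xi : V) y - g y)//.
  congr (_ - _); rewrite /rsum.
  rewrite (val_sum n (fun i => (x i.+1 - x i) *: semigroupL (xi i) f)).
  apply: eq_bigr => i _; rewrite -semigroupLE//.
  (* The tag is at least [x i], hence nonnegative, so [semigroupLE] applies. *)
  have [xi0 _] := xP i (ltn_ord i); rewrite (le_trans _ xi0)// -x0.
  by rewrite (tagged_partition_homo px)// (ltnW (ltn_ord i)).
split=> [[_ fg] e /fg[r r0 rP]|fg].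
  by exists r => // n x xi px xr; rewrite -lee_fin -E// rP.
split; first exact: L2_val.
move=> e /fg[r r0 rP]; exists r => // n x xi px xr.
by rewrite E// lee_fin rP.
Qed.

(** Since the integral exists, [xget] selects an actual integral instead of its default value. *)
Lemma time_averageE t f : 0 < t -> exists2 h : V,
  is_RInt N (semigroupL ^~ f) 0 t h &
  time_average mu p t f = (t^-1 *: h : V).
Proof.
move=> t0.
have fI : exists h : T -> R, is_L2_RInt mu (fun s => semigroup p s f) 0 t h.
  have [g fg] := semigroup_RInt_exists ND NZ semigroupL_linear semigroupL_contraction
    semigroupL_add semigroupL_0 semigroupL_cont f (@L2_complete _ _ _ mu) (ltW t0).
  by exists g; exact/is_L2_RIntP.
have hI : is_L2_RInt mu (fun s => semigroup p s f) 0 t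
    (L2_RInt mu (fun s => semigroup p s f) 0 t) by exact: (xgetPex (fun=> 0) fI).
have [hL2 _] := hI; have [h hE] := L2_lift hL2.
exists h; first by apply/is_L2_RIntP; rewrite hE.
by rewrite /time_average -hE.
Qed.

Lemma generatorE f : generator_dom mu p f -> exists2 g : V,
  is_gen N semigroupL f g & generator mu p f = g.
Proof.
move=> fdom; have fg : is_generator mu p f (generator mu p f) by exact: (xgetPex (fun=> 0) fdom).
have [_ gL2 _] := fg; have [g gE] := L2_lift gL2.
by exists g => //; apply/is_generatorP; rewrite gE.
Qed.

Lemma L20P f : L20 mu f <-> \int[mu]_x f x = 0.
Proof.
have ifin : (\int[mu]_x (f x)%:E \is a fin_num)%E.
  exact: integrable_fin_num (Lfun2_integrable f).
split=> [[_ f0]|f0]; first by rewrite /Rintegral f0.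
by split; [exact: L2_val|rewrite -(fineK ifin) -/(Rintegral mu setT f) f0].
Qed.

Lemma Rintegral_linear a u v :
  \int[mu]_x (a *: u + v : V) x = a * \int[mu]_x u x + \int[mu]_x v x.
Proof.
rewrite -RintegralZl ?Lfun2_integrable// -RintegralD ?Lfun2_integrable//.
by have := integrableZl measurableT a (Lfun2_integrable u); apply: eq_integrable.
Qed.

Lemma Rintegral_semigroupL t u : 0 <= t -> \int[mu]_x (semigroupL t u) x = \int[mu]_x u x.
Proof.
move=> t0; congr fine.
by rewrite semigroupLE// (Rintegral_bind (invariant_bind t0) (Lfun2_integrable u)).
Qed.

Lemma L20Z a f : L20 mu f -> L20 mu (a *: f : V).
Proof.
move=> /L20P f0; apply/L20P.
by rewrite -[a *: f]addr0 Rintegral_linear f0 mulr0 add0r Rintegral_cst// mul0r.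
Qed.

(** The mean is a linear functional bounded by the norm and preserved by the semigroup, so
    [integral_functional] applies. *)
Lemma L20_integral t f (h : V) : 0 < t -> L20 mu f ->
  is_RInt N (semigroupL ^~ f) 0 t h -> L20 mu h.
Proof.
move=> t0 /L20P f0 fh; apply/L20P.
rewrite (integral_functional t0 fh (phi := fun u : V => \int[mu]_x u x)) ?f0 ?mulr0//.
- exact: Rintegral_linear.
- exact: normr_Rintegral_le.
- by move=> s u s0; rewrite Rintegral_semigroupL.
Qed.

(** * Relaxation times and the singular value gap *)

Notation gap := (singular_value_gap mu p).

Lemma gap_ge0 : (0 <= gap)%E.
Proof.
apply: le_ereal_inf_tmp => _ [f _ <-].
by rewrite mule_ge0 ?inve_ge0 ?L2norm_ge0.
Qed.

(** The value chosen by [generator] may differ from [g], but only by norm 0, so the quotient is the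
    same. *)
Lemma gap_le f g : L20 mu f -> nrm2 f != 0 ->
  is_gen N semigroupL f g -> (gap <= (nrm2 g / nrm2 f)%:E)%E.
Proof.
move=> f0 nf fg; apply: ereal_inf_lbound; exists f => /=.
  split=> //; first by exists g; exact/is_generatorP.
  by move=> fE; move: nf; rewrite -[f]subr0 (eq_nrm2 (g := 0)) ?eqxx.
have [|g' fg' ->] := @generatorE f; first by exists g; exact/is_generatorP.
rewrite !nrm2E inver (negbTE nf) -EFinM; congr (_ / _)%:E.
apply/le_anti/andP; split.
  by rewrite (le_trans (seminorm_le ND _ g))// (gen_unique ND NZ fg' fg) addr0.
by rewrite (le_trans (seminorm_le ND _ g'))// (gen_unique ND NZ fg fg') addr0.
Qed.

Lemma le_gap (c : R) : (forall f g, L20 mu f -> nrm2 f != 0 ->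
    is_gen N semigroupL f g -> c <= nrm2 g / nrm2 f) ->
  (c%:E <= gap)%E.
Proof.
move=> cP; apply: le_ereal_inf_tmp => _ [f0 [+ f0L f0N] <-].
have [f fE] := L2_lift f0L.1; rewrite -{f0}fE in f0L f0N *.
move=> /generatorE[g fg ->].
have nf : nrm2 f != 0 by apply/eqP => /fine_Lnormr_eq0.
by rewrite !nrm2E inver (negbTE nf) -EFinM lee_fin cP.
Qed.

(** Unless its norm is 0, [h] competes in the infimum defining the gap. *)
Lemma gap_integral_le t f (h : V) : 0 < t -> L20 mu f ->
  is_RInt N (semigroupL ^~ f) 0 t h ->
  nrm2 h = 0 \/ (gap <= (2 * nrm2 f / nrm2 h)%:E)%E.
Proof.
move=> t0 f0 fh; have [->|nh] := eqVneq (nrm2 h) 0; [by left|right].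
have hgen : is_gen N semigroupL h (semigroupL t f - f).
  exact: (integral_gen ND NZ semigroupL_linear semigroupL_contraction semigroupL_add semigroupL_0 semigroupL_cont t0 fh).
rewrite (le_trans (gap_le (L20_integral t0 f0 fh) nh hgen))// lee_fin.
rewrite ler_wpM2r ?invr_ge0 ?nrm2_ge0// (le_trans (nrm2D _ _))//.
by rewrite (seminormN NZ) mulrDl mul1r lerD2r semigroupL_contraction// ltW.
Qed.

Lemma L2norm_time_average_le t (f : T -> R) : L20 mu f -> 0 < t ->
  (L2norm mu (time_average mu p t f) <= 2%:E / (t%:E * gap) * L2norm mu f)%E.
Proof.
move=> f0 t0; have [F FE] := L2_lift f0.1; rewrite -{f}FE in f0 *.
have [h fh ->] := time_averageE F t0.
rewrite !nrm2E nrm2Z ger0_norm ?invr_ge0 ?(ltW t0)//.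
have [h0|] := gap_integral_le t0 f0 fh.
  rewrite h0 mulr0 mule_ge0 ?lee_fin ?nrm2_ge0// mule_ge0 ?lee_fin//.
  by rewrite inve_ge0 mule_ge0 ?gap_ge0// lee_fin ltW.
have hf : nrm2 h <= t * nrm2 F.
  exact: (integral_le ND NZ semigroupL_contraction t0 fh).
(* An infinite gap contradicts the finite bound from [gap_integral_le]. *)
have := gap_ge0; case: gap => [r| |]//; rewrite !lee_fin => r0 rh.
rewrite -EFinM inver mulf_eq0 (gt_eqF t0)/=; case: eqVneq => [r00|rN0].
  (* For [r = 0] the right-hand side is [+oo], unless [F] has norm 0: it is then [+oo * 0 = 0], and
     [hf] makes the left-hand side vanish. *)
  have [F00|FN0] := eqVneq (nrm2 F) 0.
    rewrite F00 mule0 lee_fin mulr_ge0_le0 ?invr_ge0 ?(ltW t0)//.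
    by move: hf; rewrite F00 mulr0.
  by rewrite gt0_muley ?lte_fin// gt0_mulye ?leey// lte_fin lt_def FN0 nrm2_ge0.
have {}r0 : 0 < r by rewrite lt_def rN0.
have [h0|hN0] := eqVneq (nrm2 h) 0.
  rewrite h0 mulr0 lee_fin mulr_ge0 ?nrm2_ge0// mulr_ge0// invr_ge0.
  by rewrite mulr_ge0 ?ltW.
have hp0 : 0 < nrm2 h by rewrite lt_def hN0 nrm2_ge0.
move: rh; rewrite ler_pdivlMr// => rh.
rewrite -!EFinM lee_fin invfM mulrCA -!mulrA ler_wpM2l ?invr_ge0 ?(ltW t0)//.
by rewrite mulrCA ler_pdivlMl.
Qed.

Lemma opnorm_ub A (c : R) f : (opnorm_L20 mu A <= c%:E)%E -> L20 mu f ->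
  nrm2 f = 1 -> (L2norm mu (A f) <= c%:E)%E.
Proof.
move=> Ac f0 f1; apply: le_trans Ac; apply: ereal_sup_ubound.
by exists f => //; split => //; rewrite nrm2E f1.
Qed.

(** The common form of both lower bounds; by homogeneity it is enough to consider vectors of norm
    1. *)
Lemma div_gap_le (c t : R) : 0 < c -> 0 <= t ->
  (forall f g, L20 mu f -> nrm2 f = 1 -> is_gen N semigroupL f g ->
     c <= t * nrm2 g) ->
  (c%:E / gap <= t%:E)%E.
Proof.
move=> c0 t0 cP.
have {}cP f g : L20 mu f -> nrm2 f != 0 -> is_gen N semigroupL f g ->
    c <= t * (nrm2 g / nrm2 f).
  move=> f0 nf fg; have nf0 : 0 <= (nrm2 f)^-1 by rewrite invr_ge0 nrm2_ge0.
  have := cP _ _ (L20Z (nrm2 f)^-1 f0) _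
    (genZ ND NZ semigroupL_linear semigroupL_contraction (nrm2 f)^-1 fg).
  by rewrite !nrm2Z ger0_norm// mulVf// mulrC => /(_ erefl); rewrite mulrC (mulrC (_^-1)).
move: t0; rewrite le_eqVlt => /predU1P[t0|t0].
  (* At [t = 0] an admissible [f] would give [c <= 0]; hence there is none, and the quotient by the
     gap is 0. *)
  have -> : gap = +oo%E.
    apply/eqyP => r _; apply: le_gap => f g f0 nf fg.
    by have := cP f g f0 nf fg; rewrite -t0 mul0r; lra.
  by rewrite invey mule0 lee_fin -t0.
have : ((c / t)%:E <= gap)%E.
  by apply: le_gap => f g f0 nf fg; rewrite ler_pdivrMr// mulrC cP.
case: gap => [r| |]//; last by move=> _; rewrite invey mule0 lee_fin ltW.
rewrite lee_fin => cr; have r0 : 0 < r by rewrite (lt_le_trans _ cr)// divr_gt0.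
rewrite inver gt_eqF// -EFinM lee_fin ler_pdivrMr//.
by move: cr; rewrite ler_pdivrMr// mulrC.
Qed.

Lemma gap_t_rel : ((1 - (expR 1)^-1)%:E / gap <= t_rel mu p)%E.
Proof.
have e1 : 0 < 1 - (expR 1)^-1 :> R by rewrite subr_gt0 invf_lt1 ?expR_gt0// expR_gt1.
apply: le_ereal_inf_tmp => _ [t [t0 tP] <-]; apply: div_gap_le => // f g f0 f1 fg.
have := opnorm_ub tP f0 f1; rewrite -semigroupLE// nrm2E lee_fin => Pf.
have := semigroup_gen_le ND NZ semigroupL_linear semigroupL_contraction semigroupL_add semigroupL_0 t0 fg.
have := seminorm_le ND f (semigroupL t f).
by rewrite (seminormB NZ) f1; lra.
Qed.

(** The distance from [f] to its time average is at least [1 - c], and at most [s / 2 * nrm2 g] by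
    [integral_sub_le]. *)
Lemma gap_time_average_le (s c : R) : 0 < s ->
  (opnorm_L20 mu (time_average mu p s) <= c%:E)%E ->
  forall f g, L20 mu f -> nrm2 f = 1 -> is_gen N semigroupL f g ->
  2 * (1 - c) <= s * nrm2 g.
Proof.
move=> s0 sP f g f0 f1 fg.
have := opnorm_ub sP f0 f1; have [h fh ->] := time_averageE f s0.
rewrite nrm2E lee_fin => hc.
have := integral_sub_le ND NZ semigroupL_linear semigroupL_contraction semigroupL_add semigroupL_0 s0 fh fg.
have -> : h - s *: f = s *: (s^-1 *: h - f).
  by rewrite scalerBr scalerA mulfV ?gt_eqF// scale1r.
rewrite nrm2Z gtr0_norm// expr2 -!mulrA ler_pM2l// => hf.
have := seminorm_le ND f (s^-1 *: h).
by rewrite (seminormB NZ) f1; lra.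
Qed.

Lemma gap_t_rel_bar : ((2 * (1 - (expR 1)^-1))%:E / gap <= t_rel_bar mu p)%E.
Proof.
have e1 : 0 < 2 * (1 - (expR 1)^-1) :> R.
  by rewrite mulr_gt0// subr_gt0 invf_lt1 ?expR_gt0// expR_gt1.
apply: le_ereal_inf_tmp => _ [t [t0 tP] <-]; apply: div_gap_le => // f g f0 f1 fg.
apply/ler_addgt0Pr => e e0.
have n1 : 0 < nrm2 g + 1 by rewrite ltr_wpDl// nrm2_ge0.
(* As [t] may be 0, the bound is used at a positive time slightly beyond [t], chosen so that
   [s * nrm2 g <= t * nrm2 g + e]. *)
pose s := t + e / (nrm2 g + 1).
have s0 : 0 < s by rewrite ltr_wpDl// divr_gt0.
have ts : t <= s by rewrite lerDl ltW// divr_gt0.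
rewrite (le_trans (gap_time_average_le s0 (tP s s0 ts) f0 f1 fg))//.
rewrite /s mulrDl lerD2l mulrAC ler_pdivrMr// ler_wpM2l ?(ltW e0)//; lra.
Qed.

(** A time [r] is admissible once the bound on time averages is at most [1 / e] for all [s >= r];
    for a finite positive gap this holds at [r = 2 * e / gap]. *)
Lemma t_rel_bar_le : (t_rel_bar mu p <= (2 * expR 1)%:E / gap)%E.
Proof.
have key (r : R) : 0 <= r -> (forall s : R, 0 < s -> r <= s ->
    (2%:E / (s%:E * gap) <= ((expR 1)^-1)%:E)%E) -> (t_rel_bar mu p <= r%:E)%E.
  move=> r0 rP; apply: ereal_inf_lbound; exists r => //; split => // s s0 rs.
  apply: ge_ereal_sup => _ [f [f0 f1] <-].
  rewrite (le_trans (L2norm_time_average_le f0 s0))//.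
  rewrite (le_trans _ (rP s s0 rs))// -[leRHS]mule1 lee_wpmul2l//.
  by rewrite mule_ge0// ?lee_fin// inve_ge0 mule_ge0 ?gap_ge0// lee_fin ltW.
(* For an infinite gap [r = 0] is admissible; for a zero gap the right-hand side is [+oo]. *)
have := gap_ge0; move: key; case: gap => [r| |]// key; last first.
  move=> _; rewrite invey mule0; apply: key => // s s0 _.
  by rewrite gt0_muley ?lte_fin// invey mule0 lee_fin invr_ge0 expR_ge0.
rewrite lee_fin le_eqVlt => /predU1P[<-|r0].
  by rewrite inve0 gt0_muley ?leey// lte_fin mulr_gt0// expR_gt0.
rewrite inver gt_eqF// -EFinM; apply: key.
  by rewrite divr_ge0 ?(ltW r0)// mulr_ge0// expR_ge0.
move=> s s0; rewrite ler_pdivrMr// => rs.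
rewrite -EFinM inver gt_eqF ?mulr_gt0// -EFinM lee_fin.
rewrite ler_pdivrMr ?mulr_gt0// ler_pdivlMl ?expR_gt0//.
by rewrite mulrC.
Qed.

End markov_semigroup.

Unset Implicit Arguments.

Theorem theorem7 (R : realType) (S : ptopologicalType)
    (mu : probability (borel S) R) (p : R -> R.-pker (borel S) ~> (borel S))
    (hS : polish_space R S)
    (hp : transition_function p)
    (hmu : invariant_measure mu p)
    (hP : strongly_continuous mu p) :
  [/\ ((2 * (1 - (expR 1)^-1))%:E / singular_value_gap mu p <= t_rel_bar mu p)%E,
      (t_rel_bar mu p <= (2 * expR 1)%:E / singular_value_gap mu p)%E,
      ((1 - (expR 1)^-1)%:E / singular_value_gap mu p <= t_rel mu p)%E &
      forall (f : S -> R) (t : R), L20 mu f -> 0 < t ->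
        (L2norm mu (time_average mu p t f) <=
           2%:E / (t%:E * singular_value_gap mu p) * L2norm mu f)%E].
Proof.
split.
- exact: gap_t_rel_bar.
- exact: t_rel_bar_le.
- exact: gap_t_rel.
- by move=> f t f0 t0; exact: L2norm_time_average_le.
Qed.
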